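(* Weak bisimilarity $\equiv$ on closed TX10 configurations is a congruence: it is an equivalence relation, and whenever $\langle s,g\rangle\equiv\langle t,g\rangle$ then $\langle C[s],g\rangle\equiv\langle C[t],g\rangle$ for every one-hole TX10 statement context $C[\cdot]$ such that $C[s]$ and $C[t]$ are closed.
   Context: **Syntax.** $\mathsf{Pl}=\{0,\dots,n-1\}$ is a finite set of places (ranged over by $p,q$). $\mathsf{ObjId}$ is an infinite set of object ids with a fixed bijection with $\mathbb N$ (the enumeration order); $\mathsf p:\mathsf{ObjId}\to\mathsf{Pl}$ gives the home place; $\mathsf{ObjId}_q=\{o:\mathsf p(o)=q\}$; global references are $\mathsf{grObjId}=\{o\$p : o\in\mathsf{ObjId}_p\}$. Values $v$: object ids $o$, global references $o\$p$, exception constants $\mathsf E,\mathsf{BF},\mathsf{BG},\mathsf{DP}$. Expressions: $e::= v\mid x\mid e.f\mid\{f_1{:}e_1,\dots,f_n{:}e_n\}\mid \mathtt{globalref}\ e\mid\mathtt{valof}\ e$. Statements: $s,t::=\mathtt{skip}\mid\mathtt{throw}\ v$ ($v$ an exception constant) $\mid \mathtt{val}\ x=e\ s\mid e.f=e'\mid\{s\ t\}\mid\mathtt{at}(p)(\mathtt{val}\ x=e)\,s\mid\mathtt{async}\ s\mid\mathtt{finish}\ s\mid\mathtt{try}\ s\ \mathtt{catch}\ t$, plus the dynamic (runtime only) statements $\overline{\mathtt{at}}(p)\,s\mid\overline{\mathtt{async}}\,s\mid\mathtt{finish}_\mu\,s$ with $\mu$ a finite set of exception values; $\mathtt{finish}\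 s$ abbreviates $\mathtt{finish}_\emptyset\,s$. In $\mathtt{val}\ x=e\ s$ and $\mathtt{at}(p)(\mathtt{val}\ x=e)s$ the only free variable of $s$ is $x$. A configuration is closed if its statement has no free variables. **Heaps.** A local heap $h$ is a finite partial map from object ids to objects, an object being a finite partial map from field names to values. In TX10 a global heap $g$ maps every place of $\mathsf{Pl}$ to a local heap. $f[a\mapsto b]$ denotes map update. For $o\in\mathrm{dom}(h)$, $h_o$ is the set of object ids (local or global) reachable from $o$ in $h$ via fields. $g$ is place-local if for every $q\in\mathrm{dom}(g)$, with $h=g(q)$: $\mathrm{dom}(h)\subseteq\mathsf{ObjId}_q$ and $h_o\subseteq(\mathsf{ObjId}_q\cap\mathrm{dom}(h))\cup\mathsf{grObjId}$ for all $o\in\mathrm{dom}(h)$. **Predicates.** $\mathsf{isAsync}(\overline{\mathtt{async}}\,s)$; $\mathsf{isAsync}(s)$ implies $\mathsf{isAsync}(\overline{\mathtt{at}}(p)s)$ and $\mathsf{isAsync}(\mathtt{try}\,s\,\mathtt{catch}\,t)$; $\mathsf{isAsync}(s)$ and $\mathsf{isAsync}(t)$ imply $\mathsf{isAsync}(\{s\ t\})$. $\mathsf{isSync}$ holds of $\mathtt{skip}$, $\mathtt{val}\ x=e\ s$, $e.f=e'$, $\mathtt{at}(p)(\mathtt{val}\ x=e)s$, $\mathtt{async}\ s$, $\mathtt{finish}_\mu\,s$, $\mathtt{throw}\ v$; and $\mathsf{isSync}(s)$ implies $\mathsf{isSync}$ of $\{s\ t\}$, $\{t\ s\}$, $\overline{\mathtt{at}}(p)s$,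 $\mathtt{try}\,s\,\mathtt{catch}\,t$. **Transitions.** Configurations $k$ are $\langle s,g\rangle$ or $g$ (terminated). Labels $\lambda$: $\epsilon$ (normal), $v\otimes$ (synchronous exception), $v\times$ (asynchronous exception). $\to_p$ means $\xrightarrow{\epsilon}_p$. In rules, ''$A\mid B$'' in premise and conclusion denotes two rules, matching first with first and second with second. *Expressions* (at place $p$, local heap $h$): $\langle\{f_1{:}v_1,\dots,f_n{:}v_n\},h\rangle\to_p\langle o,h[o\mapsto\{f_i\mapsto v_i\}]\rangle$ with $o\in\mathsf{ObjId}_p\setminus\mathrm{dom}(h)$; $\langle o.f,h\rangle\to_p\langle v,h\rangle$ if $h(o)(f)=v$; $\langle o.f,h\rangle\xrightarrow{\mathsf{BF}\otimes}_p h$ if $f\notin\mathrm{dom}(h(o))$; $\langle\mathtt{globalref}\ o,h\rangle\to_p\langle o\$p,h\rangle$; $\langle\mathtt{valof}\ o\$p,h\rangle\to_p\langle o,h\rangle$; $\langle\mathtt{valof}\ v,h\rangle\xrightarrow{\mathsf{BG}\otimes}_p h$ if $v$ is not of the form $o\$p$; and if $\langle e,h\rangle\xrightarrow{\lambda}_p\langle e',h'\rangle\mid h$ then the same label is taken in the contexts $[\,].f$, $\mathtt{globalref}\,[\,]$, $\mathtt{valof}\,[\,]$, $\{f_1{:}v_1,\dots,f_i{:}v_i,f_{i+1}{:}[\,],\dots\}$ (leading to $h$ in the exceptional case). *Basic statements* (all require $p\in\mathrm{dom}(g)$): $\langle\mathtt{skip},g\rangle\to_p g$; $\langle\mathtt{throw}\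 v,g\rangle\xrightarrow{v\otimes}_p g$; if $\langle s[v/x],g\rangle\xrightarrow{\lambda}_p\langle s',g'\rangle\mid g'$ then $\langle\mathtt{val}\ x=v\ s,g\rangle\xrightarrow{\lambda}_p\langle s',g'\rangle\mid g'$; $\langle o.f=v,g\rangle\to_p g[p\mapsto g(p)[o\mapsto g(p)(o)[f\mapsto v]]]$ if $f\in\mathrm{dom}(g(p)(o))$; $\langle o.f=v,g\rangle\xrightarrow{\mathsf{BF}\otimes}_p g$ if $f\notin\mathrm{dom}(g(p)(o))$; (Ctx) if $\langle e,g(p)\rangle\xrightarrow{\lambda}_p\langle e',h'\rangle\mid h'$ and $g'=g[p\mapsto h']$ then $\mathtt{val}\ x=e\ s$, $e.f=e_1$, $o.f=e$, $\mathtt{at}(q)(\mathtt{val}\ x=e)s$ in heap $g$ make a $\lambda$-step at $p$ to the same statement with $e'$ for $e$ in heap $g'$, resp. to $g'$. *Copy.* For $o\in\mathsf{ObjId}$ and $q\in\mathrm{dom}(g)$, $\mathsf{copy}(o,q,g)=(o',g[q\mapsto h'])$ where $h'$ extends $h=g(q)$ by a fresh isomorphic copy, rooted at $o'$, of the object graph reachable from $o$ in $g(\mathsf p(o))$; the new ids are the next unused elements of $\mathsf{ObjId}_q$ and global references are preserved unchanged. For other values $\mathsf{copy}(v,q,g)=(v,g)$. *Remaining TX10 rules:* (Spawn) $\langle\mathtt{async}\ s,g\rangle\to_p\langle\overline{\mathtt{async}}\,s,g\rangle$. (Async) if $\langle s,g\rangle\xrightarrow{\lambda}_p\langle s',g'\rangle\mid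 g'$ then $\langle\overline{\mathtt{async}}\,s,g\rangle\xrightarrow{\lambda'}_p\langle\overline{\mathtt{async}}\,s',g'\rangle\mid g'$, with $\lambda'=\epsilon$ if $\lambda=\epsilon$ and $\lambda'=v\times$ if $\lambda\in\{v\times,v\otimes\}$. (Finish) if $\langle s,g\rangle\xrightarrow{\lambda}_p\langle s',g'\rangle$ then $\langle\mathtt{finish}_\mu s,g\rangle\to_p\langle\mathtt{finish}_{\mu\cup\lambda}s',g'\rangle$, where $\mu\cup\epsilon=\mu$ and $\mu\cup v\times=\mu\cup v\otimes=\mu\cup\{v\}$. (End of Finish) if $\langle s,g\rangle\xrightarrow{\lambda}_p g'$ then $\langle\mathtt{finish}_\mu s,g\rangle\xrightarrow{\lambda'}_p g'$ with $\lambda'=\epsilon$ if $\mu\cup\lambda=\emptyset$, else $\lambda'=\mathsf E\otimes$. (Seq) if $\langle s,g\rangle\xrightarrow{\lambda}_p\langle s',g'\rangle\mid g'$: if $\lambda\in\{\epsilon,v\times\}$, $\langle\{s\ t\},g\rangle\xrightarrow{\lambda}_p\langle\{s'\ t\},g'\rangle\mid\langle t,g'\rangle$; if $\lambda=v\otimes$, $\langle\{s\ t\},g\rangle\xrightarrow{\lambda}_p\langle s',g'\rangle\mid g'$. (Par) if $\mathsf{isAsync}(t)$ and $\langle s,g\rangle\xrightarrow{\lambda}_p\langle s',g'\rangle\mid g'$ then $\langle\{t\ s\},g\rangle\xrightarrow{\lambda}_p\langle\{t\ s'\},g'\rangle\mid\langle t,g'\rangle$. (Place Shift) if $(v',g')=\mathsf{copy}(v,q,g)$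 then $\langle\mathtt{at}(q)(\mathtt{val}\ x=v)s,g\rangle\to_p\langle\overline{\mathtt{at}}(q)\{s[v'/x]\ \mathtt{skip}\},g'\rangle$. (At) if $\langle s,g\rangle\xrightarrow{\lambda}_q\langle s',g'\rangle\mid g'$ then $\langle\overline{\mathtt{at}}(q)s,g\rangle\xrightarrow{\lambda}_p\langle\overline{\mathtt{at}}(q)s',g'\rangle\mid g'$. (Try) if $\langle s,g\rangle\xrightarrow{\lambda}_p\langle s',g'\rangle\mid g'$: if $\lambda\in\{\epsilon,v\times\}$, $\langle\mathtt{try}\,s\,\mathtt{catch}\,t,g\rangle\xrightarrow{\lambda}_p\langle\mathtt{try}\,s'\,\mathtt{catch}\,t,g'\rangle\mid g'$; if $\lambda=v\otimes$, $\langle\mathtt{try}\,s\,\mathtt{catch}\,t,g\rangle\to_p\langle\{s'\ t\},g'\rangle\mid\langle t,g'\rangle$. **Weak bisimulation.** An environment move is a map $\Phi$ on global heaps such that $\Phi(g)$ is place-local whenever $g$ is, $\mathrm{dom}(\Phi(g))=\mathrm{dom}(g)$, and $\mathrm{dom}(g(p))\subseteq\mathrm{dom}(\Phi(g)(p))$ for all $p\in\mathrm{dom}(g)$. $\overset{\lambda}{\Longrightarrow}_p$ is $(\to_p)^*\xrightarrow{\lambda}_p(\to_p)^*$ if $\lambda\neq\epsilon$, and $(\to_p)^*$ if $\lambda=\epsilon$. A binary relation $\mathcal R$ on closed configurations is a weak bisimulation if: (1) $g\,\mathcal R\,k$ implies $k=g$; (2) $\langle s,g\rangle\,\mathcal R\,k$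 implies $k=\langle t,g\rangle$ for some $t$, $\mathsf{isSync}(s)$ iff $\mathsf{isSync}(t)$, and for every environment move $\Phi$ and every place $p$: (a) if $\langle s,\Phi(g)\rangle\xrightarrow{\lambda}_p\langle s',g'\rangle$ then for some $t'$, $\langle t,\Phi(g)\rangle\overset{\lambda}{\Longrightarrow}_p\langle t',g'\rangle$ and $\langle s',g'\rangle\,\mathcal R\,\langle t',g'\rangle$, and vice versa; (b) if $\langle s,\Phi(g)\rangle\xrightarrow{\lambda}_p g'$ then $\langle t,\Phi(g)\rangle\overset{\lambda}{\Longrightarrow}_p g'$, and vice versa. Weak bisimilarity $\equiv$ is the largest weak bisimulation.
   Formalization: The body of val x=e s is assumed to contain no runtime-only statements, and a rule instance leading from a place-local heap to one that is not place-local does not count as a transition; without these two restrictions the congruence fails. *)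

(* Defs.v *)
From Stdlib Require Import Relations.
From HB Require Import structures.
From mathcomp Require Import all_boot.
From mathcomp Require Import finmap.

Set Implicit Arguments.
Unset Strict Implicit.
Unset Printing Implicit Defensive.

Local Open Scope fset_scope.
Local Open Scope fmap_scope.

Record signature := Signature {
  nplaces : nat;
  ObjId : choiceType;
  rank : ObjId -> nat;              (* the enumeration order of ObjId *)
  rank_bij : bijective rank;
  home : ObjId -> 'I_nplaces;
  Field : choiceType;
  Var : eqType
}.

Inductive exn := exnE | exnBF | exnBG | exnDP.

Definition exn_code (v : exn) : 'I_4 :=
  match v with
  | exnE => inord 0 | exnBF => inord 1 | exnBG => inord 2 | exnDP => inord 3
  end.

Definition exn_decode (i : 'I_4) : exn :=
  match val i with 0 => exnE | 1 => exnBF | 2 => exnBG | _ => exnDP end.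

Lemma exn_codeK : cancel exn_code exn_decode.
Proof. by case; rewrite /exn_decode /exn_code /= inordK. Qed.

HB.instance Definition _ := Finite.copy exn (can_type exn_codeK).

(* [Eps] is a normal step, [Sync v] a synchronous exception (v with a circled
   cross), [Async v] an asynchronous one (v with a cross). *)
Inductive label := Eps | Sync of exn | Async of exn.

Section TX10.

Context (X : signature).

Local Notation place := 'I_(nplaces X).
Local Notation ObjId := (ObjId X).
Local Notation Field := (Field X).
Local Notation Var := (Var X).

(* A global reference o$p exists only when p is the home place of o, so it is
   determined by o: [VGlob o] is o$(home o). *)
Inductive value := VObj of ObjId | VGlob of ObjId | VExn of exn.

Inductive expr :=
| EVal of value
| EVar of Var
| EField of expr & Field
| ERec of seq (Field * expr)
| EGlobalref of expr
| EValof of expr.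

(* [SFinish set0 s] is the source statement [finish s]; [SAtDyn], [SAsyncDyn]
   and [SFinish mu] with mu nonempty are the runtime-only statements. *)
Inductive stmt :=
| SSkip
| SThrow of exn
| SVal of Var & expr & stmt
| SAssign of expr & Field & expr
| SSeq of stmt & stmt
| SAt of place & Var & expr & stmt
| SAsync of stmt
| SFinish of {set exn} & stmt
| STry of stmt & stmt
| SAtDyn of place & stmt
| SAsyncDyn of stmt.

Fixpoint source (s : stmt) : bool :=
  match s with
  | SSkip | SThrow _ | SAssign _ _ _ => true
  | SVal _ _ s | SAt _ _ _ s | SAsync s => source s
  | SFinish mu s => (mu == set0) && source s
  | SSeq s t | STry s t => source s && source t
  | SAtDyn _ _ | SAsyncDyn _ => false
  end.

Fixpoint efv (e : expr) : seq Var :=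
  match e with
  | EVal _ => [::]
  | EVar x => [:: x]
  | ERec l => flatten [seq efv fe.2 | fe <- l]
  | EField e _ | EGlobalref e | EValof e => efv e
  end.

Fixpoint fv (s : stmt) : seq Var :=
  match s with
  | SSkip | SThrow _ => [::]
  | SVal x e s | SAt _ x e s => efv e ++ [seq y <- fv s | y != x]
  | SAssign e _ e' => efv e ++ efv e'
  | SSeq s t | STry s t => fv s ++ fv t
  | SAsync s | SFinish _ s | SAtDyn _ s | SAsyncDyn s => fv s
  end.

Fixpoint ewf (e : expr) : bool :=
  match e with
  | EVal _ | EVar _ => true
  | ERec l => uniq [seq fe.1 | fe <- l] && all (fun fe => ewf fe.2) l
  | EField e _ | EGlobalref e | EValof e => ewf e
  end.

(* Besides the side condition on free variables, runtime-only statements are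
   kept out of the body of a [val], which is code that has not started.  With
   S = async-bar skip and S' = async-bar {skip skip}, the statements S and S'
   are weakly bisimilar, but  val x = v S  and  val x = v S'  would not be:
   both are synchronous, the second steps to S, which is asynchronous, and the
   first can only stay put or terminate. *)
Fixpoint wf (s : stmt) : bool :=
  match s with
  | SSkip | SThrow _ => true
  | SVal x e s => [&& ewf e, wf s, all (pred1 x) (fv s) & source s]
  | SAt _ x e s => [&& ewf e, wf s & all (pred1 x) (fv s)]
  | SAssign e _ e' => ewf e && ewf e'
  | SSeq s t | STry s t => wf s && wf t
  | SAsync s | SFinish _ s | SAtDyn _ s | SAsyncDyn s => wf s
  end.

Definition closed (s : stmt) : Prop := wf s /\ fv s = [::].

Fixpoint esubst (x : Var) (v : value) (e : expr) : expr :=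
  match e with
  | EVal w => EVal w
  | EVar y => if y == x then EVal v else EVar y
  | EField e f => EField (esubst x v e) f
  | ERec l => ERec [seq (fe.1, esubst x v fe.2) | fe <- l]
  | EGlobalref e => EGlobalref (esubst x v e)
  | EValof e => EValof (esubst x v e)
  end.

Fixpoint subst (x : Var) (v : value) (s : stmt) : stmt :=
  match s with
  | SSkip => SSkip
  | SThrow w => SThrow w
  | SVal y e s => SVal y (esubst x v e) (if y == x then s else subst x v s)
  | SAssign e f e' => SAssign (esubst x v e) f (esubst x v e')
  | SSeq s t => SSeq (subst x v s) (subst x v t)
  | SAt q y e s => SAt q y (esubst x v e) (if y == x then s else subst x v s)
  | SAsync s => SAsync (subst x v s)
  | SFinish mu s => SFinish mu (subst x v s)
  | STry s t => STry (subst x v s) (subst x v t)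
  | SAtDyn q s => SAtDyn q (subst x v s)
  | SAsyncDyn s => SAsyncDyn (subst x v s)
  end.

Definition object := {fmap Field -> value}.
Definition heap := {fmap ObjId -> object}.

(* Every place has a local heap, so the domain of a global heap is the whole
   set of places. *)
Definition gheap := {ffun place -> heap}.

Definition gset (g : gheap) (p : place) (h : heap) : gheap :=
  [ffun q => if q == p then h else g q].

Inductive reachable (h : heap) (o : ObjId) : value -> Prop :=
| reachable_root : reachable h o (VObj o)
| reachable_field o1 ob f v :
    reachable h o (VObj o1) -> h.[? o1] = Some ob -> ob.[? f] = Some v ->
    reachable h o v.

Definition place_local (g : gheap) : Prop :=
  forall q o, o \in g q ->
    home o = q /\
    (forall o1, reachable (g q) o (VObj o1) -> home o1 = q /\ o1 \in g q).

Definition rename (iota : ObjId -> ObjId) (v : value) : value :=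
  if v is VObj o then VObj (iota o) else v.

Definition rename_object (iota : ObjId -> ObjId) (ob : object) : object :=
  [fmap f : domf ob => rename iota (ob f)].

(* h' extends h by a copy of the part of h0 reachable from o, each o1 there
   becoming iota o1.  The new ids are the first unused ids of place q; they are
   assigned in the order of the originals, which determines iota on the copied
   ids. *)
Record graph_copy (h0 : heap) (o : ObjId) (q : place) (h : heap)
    (iota : ObjId -> ObjId) (h' : heap) : Prop := GraphCopy {
  copied o1 := reachable h0 o (VObj o1);
  copied_dom : forall o1, copied o1 -> o1 \in h0;
  copied_fresh : forall o1, copied o1 -> home (iota o1) = q /\ iota o1 \notin h;
  copied_next : forall o1 x, copied o1 -> home x = q -> x \notin h ->
    rank x < rank (iota o1) -> exists2 o2, copied o2 & x = iota o2;
  copied_mono : forall o1 o2, copied o1 -> copied o2 ->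
    rank o1 < rank o2 -> rank (iota o1) < rank (iota o2);
  copy_old : forall x, x \in h -> h'.[? x] = h.[? x];
  copy_new : forall o1, copied o1 ->
    h'.[? iota o1] = omap (rename_object iota) h0.[? o1];
  copy_dom : forall x, x \in h' -> x \in h \/ exists2 o1, copied o1 & x = iota o1
}.

Inductive copy : value -> place -> gheap -> value -> gheap -> Prop :=
| copy_obj o q (g : gheap) iota h' :
    graph_copy (g (home o)) o q (g q) iota h' ->
    copy (VObj o) q g (VObj (iota o)) (gset g q h')
| copy_other v q (g : gheap) : (forall o, v <> VObj o) -> copy v q g v g.

Inductive isAsync : stmt -> Prop :=
| isAsync_async s : isAsync (SAsyncDyn s)
| isAsync_at p s : isAsync s -> isAsync (SAtDyn p s)
| isAsync_try s t : isAsync s -> isAsync (STry s t)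
| isAsync_seq s t : isAsync s -> isAsync t -> isAsync (SSeq s t).

Inductive isSync : stmt -> Prop :=
| isSync_skip : isSync SSkip
| isSync_val x e s : isSync (SVal x e s)
| isSync_assign e f e' : isSync (SAssign e f e')
| isSync_atval p x e s : isSync (SAt p x e s)
| isSync_async s : isSync (SAsync s)
| isSync_finish mu s : isSync (SFinish mu s)
| isSync_throw v : isSync (SThrow v)
| isSync_seql s t : isSync s -> isSync (SSeq s t)
| isSync_seqr s t : isSync s -> isSync (SSeq t s)
| isSync_at p s : isSync s -> isSync (SAtDyn p s)
| isSync_try s t : isSync s -> isSync (STry s t).

Inductive econfig := ERun of expr & heap | EDone of heap.

(* The evaluation contexts of expressions. *)
Inductive ectx :=
| XField of Field
| XGlobalref
| XValof
| XRec of seq (Field * value) & Field & seq (Field * expr).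

Definition vals (fvs : seq (Field * value)) : seq (Field * expr) :=
  [seq (fw.1, EVal fw.2) | fw <- fvs].

Definition efill (K : ectx) (e : expr) : expr :=
  match K with
  | XField f => EField e f
  | XGlobalref => EGlobalref e
  | XValof => EValof e
  | XRec fvs f fes => ERec (vals fvs ++ (f, e) :: fes)
  end.

Definition new_object (fvs : seq (Field * value)) : object :=
  foldr (fun fw (ob : object) => ob.[fw.1 <- fw.2]) [fmap] fvs.

Inductive estep (p : place) : expr -> heap -> label -> econfig -> Prop :=
| e_new fvs (h : heap) o :
    home o = p -> o \notin h ->
    estep p (ERec (vals fvs)) h Eps
      (ERun (EVal (VObj o)) h.[o <- new_object fvs])
| e_select o f (h : heap) (ob : object) v :
    h.[? o] = Some ob -> ob.[? f] = Some v ->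
    estep p (EField (EVal (VObj o)) f) h Eps (ERun (EVal v) h)
| e_select_bad o f (h : heap) (ob : object) :
    h.[? o] = Some ob -> f \notin ob ->
    estep p (EField (EVal (VObj o)) f) h (Sync exnBF) (EDone h)
| e_globalref o h :
    home o = p ->
    estep p (EGlobalref (EVal (VObj o))) h Eps (ERun (EVal (VGlob o)) h)
| e_valof o h :
    home o = p ->
    estep p (EValof (EVal (VGlob o))) h Eps (ERun (EVal (VObj o)) h)
| e_valof_bad v h :
    (forall o, home o = p -> v <> VGlob o) ->
    estep p (EValof (EVal v)) h (Sync exnBG) (EDone h)
| e_ctx K e h l e' h' :
    estep p e h l (ERun e' h') ->
    estep p (efill K e) h l (ERun (efill K e') h')
| e_ctx_done K e h l h' :
    estep p e h l (EDone h') -> estep p (efill K e) h l (EDone h').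

(* The expression contexts of statements. *)
Inductive sctx :=
| YVal of Var & stmt
| YAssignL of Field & expr
| YAssignR of ObjId & Field
| YAt of place & Var & stmt.

Definition sfill (K : sctx) (e : expr) : stmt :=
  match K with
  | YVal x s => SVal x e s
  | YAssignL f e1 => SAssign e f e1
  | YAssignR o f => SAssign (EVal (VObj o)) f e
  | YAt q x s => SAt q x e s
  end.

Inductive config := Run of stmt & gheap | Done of gheap.

Definition heap_of (k : config) : gheap :=
  match k with Run _ g => g | Done g => g end.

Definition label_async (l : label) : label :=
  match l with Eps => Eps | Sync v | Async v => Async v end.

Definition is_sync_label (l : label) : bool :=
  if l is Sync _ then true else false.

Definition add_label (mu : {set exn}) (l : label) : {set exn} :=
  match l with Eps => mu | Sync v | Async v => (mu :|: [set v])%SET end.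

Inductive step (p : place) : stmt -> gheap -> label -> config -> Prop :=
| s_skip g : step p SSkip g Eps (Done g)
| s_throw v g : step p (SThrow v) g (Sync v) (Done g)
| s_val x v s g l k :
    step p (subst x v s) g l k -> step p (SVal x (EVal v) s) g l k
| s_assign o f v (g : gheap) (ob : object) :
    (g p).[? o] = Some ob -> f \in ob ->
    step p (SAssign (EVal (VObj o)) f (EVal v)) g Eps
      (Done (gset g p (g p).[o <- ob.[f <- v]]))
| s_assign_bad o f v (g : gheap) (ob : object) :
    (g p).[? o] = Some ob -> f \notin ob ->
    step p (SAssign (EVal (VObj o)) f (EVal v)) g (Sync exnBF) (Done g)
| s_ctx K e (g : gheap) l e' h' :
    estep p e (g p) l (ERun e' h') ->
    step p (sfill K e) g l (Run (sfill K e') (gset g p h'))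
| s_ctx_done K e (g : gheap) l h' :
    estep p e (g p) l (EDone h') ->
    step p (sfill K e) g l (Done (gset g p h'))
| s_spawn s g : step p (SAsync s) g Eps (Run (SAsyncDyn s) g)
| s_async s g l s' g' :
    step p s g l (Run s' g') ->
    step p (SAsyncDyn s) g (label_async l) (Run (SAsyncDyn s') g')
| s_async_done s g l g' :
    step p s g l (Done g') ->
    step p (SAsyncDyn s) g (label_async l) (Done g')
| s_finish mu s g l s' g' :
    step p s g l (Run s' g') ->
    step p (SFinish mu s) g Eps (Run (SFinish (add_label mu l) s') g')
| s_finish_end mu s g l g' :
    step p s g l (Done g') ->
    step p (SFinish mu s) g
      (if add_label mu l == set0 then Eps else Sync exnE) (Done g')
| s_seq s t g l s' g' :
    ~~ is_sync_label l -> step p s g l (Run s' g') ->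
    step p (SSeq s t) g l (Run (SSeq s' t) g')
| s_seq_done s t g l g' :
    ~~ is_sync_label l -> step p s g l (Done g') ->
    step p (SSeq s t) g l (Run t g')
| s_seq_exn s t g v k :
    step p s g (Sync v) k -> step p (SSeq s t) g (Sync v) k
| s_par t s g l s' g' :
    isAsync t -> step p s g l (Run s' g') ->
    step p (SSeq t s) g l (Run (SSeq t s') g')
| s_par_done t s g l g' :
    isAsync t -> step p s g l (Done g') ->
    step p (SSeq t s) g l (Run t g')
| s_shift q x v s g v' g' :
    copy v q g v' g' ->
    step p (SAt q x (EVal v) s) g Eps
      (Run (SAtDyn q (SSeq (subst x v' s) SSkip)) g')
| s_at q s g l s' g' :
    step q s g l (Run s' g') ->
    step p (SAtDyn q s) g l (Run (SAtDyn q s') g')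
| s_at_done q s g l g' :
    step q s g l (Done g') -> step p (SAtDyn q s) g l (Done g')
| s_try s t g l s' g' :
    ~~ is_sync_label l -> step p s g l (Run s' g') ->
    step p (STry s t) g l (Run (STry s' t) g')
| s_try_done s t g l g' :
    ~~ is_sync_label l -> step p s g l (Done g') ->
    step p (STry s t) g l (Done g')
| s_try_exn s t g v s' g' :
    step p s g (Sync v) (Run s' g') ->
    step p (STry s t) g Eps (Run (SSeq s' t) g')
| s_try_exn_done s t g v g' :
    step p s g (Sync v) (Done g') -> step p (STry s t) g Eps (Run t g').

(* The transitions of TX10 are the rule instances that preserve place-locality.
   The rules alone do not ensure it: nothing stops an object id that is not
   allocated at p, written in the program or obtained by [valof] from a
   dangling global reference, from being stored in the heap of p.  As
   environment moves are unconstrained on heaps that are not place-local,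
   weak bisimilarity would not be a congruence if such steps were allowed: a
   context could leave the place-local heaps, on which alone its argument has
   been tested. *)
Definition trans (p : place) (k : config) (l : label) (k' : config) : Prop :=
  match k with
  | Run s g => step p s g l k' /\ (place_local g -> place_local (heap_of k'))
  | Done _ => False
  end.

Definition taus (p : place) : relation config :=
  clos_refl_trans config (fun k k' => trans p k Eps k').

Definition weak (p : place) (k : config) (l : label) (k' : config) : Prop :=
  if l is Eps then taus p k k'
  else exists k1 k2, [/\ taus p k k1, trans p k1 l k2 & taus p k2 k'].

Definition environment_move (Phi : gheap -> gheap) : Prop :=
  (forall g, place_local g -> place_local (Phi g)) /\
  (forall (g : gheap) p, domf (g p) `<=` domf (Phi g p)).

Definition closed_config (k : config) : Prop :=
  if k is Run s _ then closed s else True.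

Definition weak_bisimulation (R : relation config) : Prop :=
  [/\ forall k1 k2, R k1 k2 -> closed_config k1 /\ closed_config k2,
      forall g k, R (Done g) k -> k = Done g
    & forall s g k, R (Run s g) k ->
      exists t, [/\ k = Run t g, isSync s <-> isSync t
        & forall Phi p, environment_move Phi ->
          [/\ forall l s' g', trans p (Run s (Phi g)) l (Run s' g') ->
                exists2 t', weak p (Run t (Phi g)) l (Run t' g')
                  & R (Run s' g') (Run t' g'),
              forall l t' g', trans p (Run t (Phi g)) l (Run t' g') ->
                exists2 s', weak p (Run s (Phi g)) l (Run s' g')
                  & R (Run s' g') (Run t' g'),
              forall l g', trans p (Run s (Phi g)) l (Done g') ->
                weak p (Run t (Phi g)) l (Done g')
            & forall l g', trans p (Run t (Phi g)) l (Done g') ->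
                weak p (Run s (Phi g)) l (Done g')]]].

Definition weakly_bisimilar (k1 k2 : config) : Prop :=
  exists2 R, weak_bisimulation R & R k1 k2.

(* One-hole statement contexts. *)
Inductive ctx :=
| CHole
| CVal of Var & expr & ctx
| CSeqL of ctx & stmt
| CSeqR of stmt & ctx
| CAt of place & Var & expr & ctx
| CAsync of ctx
| CFinish of {set exn} & ctx
| CTryL of ctx & stmt
| CTryR of stmt & ctx
| CAtDyn of place & ctx
| CAsyncDyn of ctx.

Fixpoint plug (C : ctx) (s : stmt) : stmt :=
  match C with
  | CHole => s
  | CVal x e C => SVal x e (plug C s)
  | CSeqL C t => SSeq (plug C s) t
  | CSeqR t C => SSeq t (plug C s)
  | CAt q x e C => SAt q x e (plug C s)
  | CAsync C => SAsync (plug C s)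
  | CFinish mu C => SFinish mu (plug C s)
  | CTryL C t => STry (plug C s) t
  | CTryR t C => STry t (plug C s)
  | CAtDyn q C => SAtDyn q (plug C s)
  | CAsyncDyn C => SAsyncDyn (plug C s)
  end.

End TX10.

(* Main.v *)
(* The argument of a context is tested by the bisimulation game in every heap
   that an environment move can produce.  A transition preserves place-locality
   and only enlarges domains, so the rest of a context can change the heap from
   g to g' only if some environment move, which may fix all heaps but g, does
   the same; hence bisimilarity of two statements survives the steps of their
   context.  Each statement constructor is then shown to preserve bisimilarity
   by coinduction, weak steps being transported through the frame around the
   hole.  The constructors [val] and [at] need the induction on contexts to
   range over substitution instances: the statements put in the hole are
   closed, so a substitution commutes with plugging. *)
From Stdlib Require Import Relations.
From HB Require Import structures.
From mathcomp Require Import all_boot.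
From mathcomp Require Import finmap.
Require Import Defs.

Set Implicit Arguments.
Unset Strict Implicit.
Unset Printing Implicit Defensive.

Local Open Scope fset_scope.
Local Open Scope fmap_scope.

(** Coding values in a sum type yields decidable equality, first on values and then on global heaps:
    an environment move that alters one given heap must be able to test for that heap. *)
Definition value_code (X : signature) (v : value X) : ObjId X + ObjId X + exn :=
  match v with
  | VObj o => inl (inl o) | VGlob o => inl (inr o) | VExn w => inr w
  end.

Definition value_decode (X : signature) (c : ObjId X + ObjId X + exn) : value X :=
  match c with
  | inl (inl o) => VObj o | inl (inr o) => VGlob o | inr w => VExn _ w
  end.

Lemma value_codeK (X : signature) : cancel (@value_code X) (@value_decode X).
Proof. by case. Qed.

HB.instance Definition _ (X : signature) :=
  Choice.copy (value X) (can_type (@value_codeK X)).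

Section Bisimilarity.

Context (X : signature).

Implicit Types (p q : 'I_(nplaces X)) (x y : Var X) (v w : value X).
Implicit Types (e : expr X) (s t u : stmt X) (h : heap X) (g : gheap X).
Implicit Types (k : config X) (l : label) (C : ctx X).

(** * Free variables, substitution and closedness *)

Fixpoint every (P : expr X -> Prop) (r : seq (Field X * expr X)) : Prop :=
  if r is fe :: r' then P fe.2 /\ every P r' else True.

(** [ERec] nests [expr] inside a list of fields; [every] carries the induction hypothesis for each
    of them. *)
Lemma expr_nested_ind (P : expr X -> Prop) :
  (forall v, P (EVal v)) -> (forall x, P (EVar x)) ->
  (forall e f, P e -> P (EField e f)) ->
  (forall r, every P r -> P (ERec r)) ->
  (forall e, P e -> P (EGlobalref e)) -> (forall e, P e -> P (EValof e)) ->
  forall e, P e.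
Proof.
move=> Hval Hvar Hfield Hrec Hglob Hvalof; fix IH 1; case=> [v|x|e f|r|e|e].
- exact: Hval.
- exact: Hvar.
- exact/Hfield/IH.
- by apply: Hrec; elim: r => [|fe r IHr]; [exact: I | split; [exact: IH |]].
- exact/Hglob/IH.
- exact/Hvalof/IH.
Qed.

Lemma efv_esubst x v e : efv (esubst x v e) = [seq y <- efv e | y != x].
Proof.
elim/expr_nested_ind: e => //= [y|r IHr].
  by case: eqP => //= ->.
elim: r IHr => //= fe r IHr [IHe /IHr IHr'].
by rewrite filter_cat IHe IHr'.
Qed.

Lemma ewf_esubst x v e : ewf (esubst x v e) = ewf e.
Proof.
elim/expr_nested_ind: e => //= [y|r IHr]; first by case: eqP.
rewrite -map_comp; congr (_ && _).
by elim: r IHr => //= fe r IHr [-> /IHr ->].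
Qed.

Lemma esubst_id x v e : x \notin efv e -> esubst x v e = e.
Proof.
elim/expr_nested_ind: e => //= [y|e f IHe|r IHr|e IHe|e IHe].
- by rewrite inE eq_sym => /negPf ->.
- by move/IHe ->.
- move=> xr; congr ERec; elim: r IHr xr => //= -[f e] r IHr [/= IHe IHr'].
  by rewrite mem_cat negb_or => /andP[/IHe -> /IHr ->].
- by move/IHe ->.
- by move/IHe ->.
Qed.

Lemma fv_subst x v s : fv (subst x v s) = [seq y <- fv s | y != x].
Proof.
elim: s => //= [y e s IHs|e f e'|s IHs t IHt|q y e s IHs|s IHs t IHt];
  rewrite filter_cat ?efv_esubst ?IHs ?IHt //; congr (_ ++ _).
(* If [y] is [x], the binder already removes [x] and filtering again changes nothing; otherwise the
   two filters commute. *)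
- case: eqP => [->|_]; last rewrite IHs; rewrite -!filter_predI.
    by apply: eq_filter => z /=; rewrite andbb.
  by apply: eq_filter => z /=; rewrite andbC.
- case: eqP => [->|_]; last rewrite IHs; rewrite -!filter_predI.
    by apply: eq_filter => z /=; rewrite andbb.
  by apply: eq_filter => z /=; rewrite andbC.
Qed.

Lemma source_subst x v s : source (subst x v s) = source s.
Proof.
elim: s => //= [y e s IHs|s -> t -> //|q y e s IHs|mu s -> //|s -> t -> //];
  by case: eqP.
Qed.

Lemma wf_subst x v s : wf s -> wf (subst x v s).
Proof.
elim: s => //= [y e s IHs|e f e'|s IHs t IHt|q y e s IHs|s IHs t IHt].
- rewrite ewf_esubst => /and4P[-> ws fs ss]; case: eqP => _ /=.
    by rewrite ws fs ss.
  by rewrite IHs // source_subst ss fv_subst andbT; apply/allP => z;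
    rewrite mem_filter => /andP[_ /(allP fs)].
- by rewrite !ewf_esubst.
- by case/andP=> /IHs -> /IHt ->.
- rewrite ewf_esubst => /and3P[-> ws fs]; case: eqP => _ /=.
    by rewrite ws fs.
  by rewrite IHs // fv_subst; apply/allP => z;
    rewrite mem_filter => /andP[_ /(allP fs)].
- by case/andP=> /IHs -> /IHt ->.
Qed.

Lemma closed_subst x v s :
  wf s -> all (pred1 x) (fv s) -> closed (subst x v s).
Proof.
move=> ws fs; split; first exact: wf_subst.
rewrite fv_subst; apply/eqP; rewrite -[_ == _]negbK -has_filter.
by apply/hasPn => y /(allP fs) /= /eqP ->; rewrite eqxx.
Qed.

Lemma subst_id x v s : x \notin fv s -> subst x v s = s.
Proof.
elim: s => //= [y e s IHs|e f e'|s IHs t IHt|q y e s IHs|s IHs|mu s IHs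
               |s IHs t IHt|q s IHs|s IHs].
- rewrite mem_cat negb_or mem_filter negb_and negbK.
  case/andP=> /esubst_id ->; rewrite eq_sym; case: eqP => //= _.
  by move/IHs ->.
- by rewrite mem_cat negb_or => /andP[/esubst_id -> /esubst_id ->].
- by rewrite mem_cat negb_or => /andP[/IHs -> /IHt ->].
- rewrite mem_cat negb_or mem_filter negb_and negbK.
  case/andP=> /esubst_id ->; rewrite eq_sym; case: eqP => //= _.
  by move/IHs ->.
- by move/IHs ->.
- by move/IHs ->.
- by rewrite mem_cat negb_or => /andP[/IHs -> /IHt ->].
- by move/IHs ->.
- by move/IHs ->.
Qed.

Lemma cat_nil (T : Type) (a b : seq T) : a ++ b = [::] -> a = [::] /\ b = [::].
Proof. by case: a. Qed.

Lemma closed_val x e s :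
  closed (SVal x e s) <->
  [/\ ewf e, efv e = [::], wf s, all (pred1 x) (fv s) & source s].
Proof.
split=> [[/and4P[we ws fs ss] /cat_nil[fe _]] //|[we fe ws fs ss]].
split; first by rewrite /= we ws fs ss.
rewrite /= fe; apply/eqP; rewrite -[_ == _]negbK -has_filter.
by apply/hasPn => y /(allP fs) /= /eqP ->; rewrite eqxx.
Qed.

Lemma closed_at q x e s :
  closed (SAt q x e s) <->
  [/\ ewf e, efv e = [::], wf s & all (pred1 x) (fv s)].
Proof.
split=> [[/and3P[we ws fs] /cat_nil[fe _]] //|[we fe ws fs]].
split; first by rewrite /= we ws fs.
rewrite /= fe; apply/eqP; rewrite -[_ == _]negbK -has_filter.
by apply/hasPn => y /(allP fs) /= /eqP ->; rewrite eqxx.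
Qed.

Lemma closed_assign e f e' :
  closed (SAssign e f e') <->
  [/\ ewf e, efv e = [::], ewf e' & efv e' = [::]].
Proof.
split=> [[/andP[we we'] /cat_nil[fe fe']] //|[we fe we' fe']].
by split; rewrite /= ?we ?we' ?fe ?fe'.
Qed.

Lemma closed_seq s t : closed (SSeq s t) <-> closed s /\ closed t.
Proof.
split=> [[/andP[ws wt] /cat_nil[fs ft]] //|[[ws fs] [wt ft]]].
by split; rewrite /= ?ws ?wt ?fs ?ft.
Qed.

Lemma closed_try s t : closed (STry s t) <-> closed s /\ closed t.
Proof. exact: (closed_seq s t). Qed.

(** The third conjunct serves the context rule, where a step replaces only the expression in the
    hole. *)
Lemma efill_closed K e :
  ewf (efill K e) -> efv (efill K e) = [::] ->
  [/\ ewf e, efv e = [::] &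
    forall e', ewf e' -> efv e' = [::] ->
      ewf (efill K e') /\ efv (efill K e') = [::]].
Proof.
case: K => [f|||fvs f fes] //=; rewrite !map_cat all_cat flatten_cat /=.
case/andP=> uK /and3P[wv we wf] /cat_nil[fvn /cat_nil[fe ff]]; split=> // e'.
by rewrite !map_cat all_cat flatten_cat /= uK wv wf fvn ff => -> ->.
Qed.

Lemma estep_closed p e h l e' h' :
  estep p e h l (ERun e' h') ->
  ewf e -> efv e = [::] -> ewf e' /\ efv e' = [::].
Proof.
move Ek: (ERun e' h') => ek st; elim: st e' h' Ek => //.
- by move=> fvs h0 o _ _ e' h' [-> _].
- by move=> o f h0 ob v _ _ e' h' [-> _].
- by move=> o h0 _ e' h' [-> _].
- by move=> o h0 _ e' h' [-> _].
- move=> K e0 h0 l0 e1 h1 _ IH e' h' [-> _] wK fK.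
  have [we fe HK] := efill_closed wK fK.
  by have [we1 fe1] := IH _ _ erefl we fe; apply: HK.
Qed.

Lemma sfill_closed K e :
  closed (sfill K e) ->
  [/\ ewf e, efv e = [::] &
    forall e', ewf e' -> efv e' = [::] -> closed (sfill K e')].
Proof.
case: K => [x s|f e1|o f|q x s] /=.
- move=> /closed_val[we fe ws fs ss]; split=> // e' we' fe'.
  exact/closed_val.
- move=> /closed_assign[we fe we1 fe1]; split=> // e' we' fe'.
  exact/closed_assign.
- by move=> /closed_assign[_ _ we fe]; split.
- move=> /closed_at[we fe ws fs]; split=> // e' we' fe'.
  exact/closed_at.
Qed.

(** Steps substitute only into the bodies of [val] and [at], whose only possible free variable is
    the one replaced. *)
Lemma step_closed p s g l k : step p s g l k -> closed s -> closed_config k.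
Proof.
elim=> {p s g l k} //=.
- by move=> p x v s g l k _ IH /closed_val[_ _ ws fs _]; apply/IH/closed_subst.
- move=> p K e g l e' h' st cK; have [we fe HK] := sfill_closed cK.
  by have [we' fe'] := estep_closed st we fe; apply: HK.
- by move=> p s t g l s' g' _ _ IH /closed_seq[cs ct]; apply/closed_seq; split; auto.
- by move=> p s t g l g' _ _ _ /closed_seq[].
- by move=> p s t g v k _ IH /closed_seq[cs _]; apply: IH.
- by move=> p t s g l s' g' _ _ IH /closed_seq[ct cs]; apply/closed_seq; split; auto.
- by move=> p t s g l g' _ _ _ /closed_seq[].
- move=> p q x v s g v' g' _ /closed_at[_ _ ws fs].
  by apply/(closed_seq (subst x v' s) (SSkip X)); split=> //; apply: closed_subst.
- by move=> p s t g l s' g' _ _ IH /closed_try[cs ct]; apply/closed_try; split; auto.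
- by move=> p s t g v s' g' _ IH /closed_try[cs ct]; apply/closed_seq; split; auto.
- by move=> p s t g v g' _ _ /closed_try[].
Qed.

Lemma trans_closed p s g l k : trans p (Run s g) l k -> closed s -> closed_config k.
Proof. by case=> /step_closed. Qed.

(** * Synchronous and asynchronous statements *)

(** A bisimulation compares only [isSync]. Complementarity makes it respect [isAsync] too, which the
    parallel rule requires. *)
Lemma isAsyncP s : isAsync s <-> ~ isSync s.
Proof.
split=> [|].
  by elim=> {s} [s|p s _ IH|s t _ IH|s t _ IHs _ IHt] h; inversion h; auto.
elim: s => [|v|x e s _|e f e'|s IHs t IHt|q x e s _|s _|mu s _|s IHs t _|q s IHs
           |s _] h; try by case: h; constructor.
- by constructor; [apply: IHs | apply: IHt] => h'; apply: h;
    [apply: isSync_seql | apply: isSync_seqr].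
- by constructor; apply: IHs => h'; apply/h/isSync_try.
- by constructor; apply: IHs => h'; apply/h/isSync_at.
- by constructor.
Qed.

(** Asynchrony originates only in the runtime form [SAsyncDyn], which source code excludes. *)
Lemma source_isSync s : source s -> isSync s.
Proof.
elim: s => [|v|x e s _|e f e'|s IHs t IHt|q x e s _|s _|mu s _|s IHs t _|q s IHs
           |s _] //=; try by constructor.
- by case/andP=> /IHs h _; apply: isSync_seql.
- by case/andP=> /IHs h _; apply: isSync_try.
Qed.

(** * Growth of heaps under steps and environment moves *)

(** Relates a heap to exactly its possible images under environment moves, which turns a
    quantification over maps into a preorder on heaps. *)
Definition heap_le g g' : Prop :=
  (place_local g -> place_local g') /\ (forall p, domf (g p) `<=` domf (g' p)).

Lemma heap_le_refl g : heap_le g g.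
Proof. by split=> // p; apply: fsubset_refl. Qed.

Lemma heap_le_trans g1 g2 g3 : heap_le g1 g2 -> heap_le g2 g3 -> heap_le g1 g3.
Proof.
move=> [l12 d12] [l23 d23]; split=> [/l12/l23 //|p].
exact: fsubset_trans (d12 p) (d23 p).
Qed.

Lemma environment_move_le (Phi : gheap X -> gheap X) g :
  environment_move Phi -> heap_le g (Phi g).
Proof. by case=> Hl Hd; split=> [|p]; [apply: Hl | apply: Hd]. Qed.

Lemma heap_le_environment_move g g' :
  heap_le g g' -> exists2 Phi, environment_move Phi & Phi g = g'.
Proof.
case=> Hl Hd; exists (fun g0 => if g0 == g then g' else g0); last by rewrite eqxx.
split=> [g0|g0 p]; case: eqP => [->|_] //; exact: fsubset_refl.
Qed.

Lemma estep_dom p e h l ek :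
  estep p e h l ek ->
  domf h `<=` domf (match ek with ERun _ h' => h' | EDone h' => h' end).
Proof.
elim=> //= *; try exact: fsubset_refl.
exact: fsubsetUr.
Qed.

Lemma gset_dom g p h q :
  domf (g p) `<=` domf h -> domf (g q) `<=` domf (gset g p h q).
Proof.
by rewrite /gset ffunE; case: eqP => [->|_] // _; apply: fsubset_refl.
Qed.

(** Assignment and allocation update a finite map and copying extends the target heap, so no id is
    ever lost. *)
Lemma step_dom p s g l k :
  step p s g l k -> forall q, domf (g q) `<=` domf (heap_of k q).
Proof.
elim=> {p s g l k} //=; try by move=> *; apply: fsubset_refl.
- move=> p o f v g ob _ _ q; apply: gset_dom.
  by rewrite dom_setf; apply: fsubsetUr.
- by move=> p K e g l e' h' /estep_dom /gset_dom.
- by move=> p K e g l h' /estep_dom /gset_dom.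
- move=> p q x v s g v' g' cp q'.
  case: cp => [o {}q {}g iota h' gc|*]; last exact: fsubset_refl.
  apply: gset_dom; apply/fsubsetP => o1 ho1.
  have ho1' : o1 \in g q := ho1.
  suff : o1 \in h' by [].
  rewrite -fndSome (copy_old gc) //.
  by rewrite fndSome.
Qed.

Lemma trans_heap_le p s g l k : trans p (Run s g) l k -> heap_le g (heap_of k).
Proof. by case=> st pl; split=> // q; apply: (step_dom st). Qed.

(** * Weak transitions *)

(** Gives all labels one shape: a weak silent transition is either empty or, split at its first
    step, has the form of a visible one. *)
Lemma weakP p k l k' :
  weak p k l k' <->
  (l = Eps /\ k = k') \/
  exists k1 k2, [/\ taus p k k1, trans p k1 l k2 & taus p k2 k'].
Proof.
split.
  case: l => [/=|v|v]; [|by right..].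
  move/(clos_rt_rt1n _ _ _ _); case=> [|k1 k2 t1 t2]; first by left.
  right; exists k, k1; split=> //; first exact: rt_refl.
  exact: clos_rt1n_rt.
case=> [[-> ->]|]; first exact: rt_refl.
case: l => [[k1 [k2 [h1 h2 h3]]]|v|v] //.
exact: rt_trans h1 (rt_trans _ _ _ _ _ (rt_step _ _ _ _ h2) h3).
Qed.

Lemma weak_intro p k l k' k1 k2 :
  taus p k k1 -> trans p k1 l k2 -> taus p k2 k' -> weak p k l k'.
Proof. by move=> *; apply/weakP; right; exists k1, k2. Qed.

Lemma weak_of_trans p k l k' : trans p k l k' -> weak p k l k'.
Proof. by move=> h; apply: weak_intro h _; apply: rt_refl. Qed.

(** * Weak bisimilarity as an equivalence relation *)

(** Symmetry of [R] halves the simulation clauses. Running and terminated successors can share one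
    clause because [R] itself forces the answer to have the same form and heap. *)
Lemma wb_symmetric_intro (R : relation (config X)) :
  (forall k1 k2, R k1 k2 -> R k2 k1) ->
  (forall k1 k2, R k1 k2 -> closed_config k1) ->
  (forall g k, R (Done g) k -> k = Done g) ->
  (forall s g k, R (Run s g) k -> exists t, [/\ k = Run t g, isSync s -> isSync t
     & forall Phi p l k', environment_move Phi -> trans p (Run s (Phi g)) l k' ->
         exists2 k2, weak p (Run t (Phi g)) l k2 & R k' k2]) ->
  weak_bisimulation R.
Proof.
move=> Rsym Rcl Rdone Rrun; split=> // [k1 k2 Rk|s g k Rk].
  by split; [apply: Rcl Rk | apply: Rcl (Rsym _ _ Rk)].
have [t [ek st sim]] := Rrun _ _ _ Rk; subst k.
have [s' [[es'] ts sim']] := Rrun _ _ _ (Rsym _ _ Rk); subst s'.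
exists t; split=> // Phi p HPhi; split=> [l s' g' h|l t' g' h|l g' h|l g' h].
- have [k2 w Rk2] := sim _ _ _ _ HPhi h.
  have [t' [ek2 _ _]] := Rrun _ _ _ Rk2; subst k2.
  by exists t'.
- have [k2 w Rk2] := sim' _ _ _ _ HPhi h.
  have [s' [ek2 _ _]] := Rrun _ _ _ Rk2; subst k2.
  by exists s' => //; apply: Rsym.
- by have [k2 w /Rdone ek2] := sim _ _ _ _ HPhi h; subst k2.
- by have [k2 w /Rdone ek2] := sim' _ _ _ _ HPhi h; subst k2.
Qed.

Lemma wb_refl k : closed_config k -> weakly_bisimilar k k.
Proof.
move=> ck; exists (fun k1 k2 => k1 = k2 /\ closed_config k1) => //.
apply: wb_symmetric_intro => [k1 k2 [-> //]|k1 k2 [] //|g k1 [<- //]|s g k1 [<- cs]].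
exists s; split=> // Phi p l k' _ h; exists k'; first exact: weak_of_trans.
by split=> //; apply: trans_closed h cs.
Qed.

Lemma wb_sym k1 k2 : weakly_bisimilar k1 k2 -> weakly_bisimilar k2 k1.
Proof.
case=> R [Rcl Rdone Rrun] Rk; exists (fun k k' => R k' k) => //; split.
- by move=> k k' /Rcl[].
- move=> g [s g'|g'] Rk'; last by move/Rdone: Rk'.
  by have [t []] := Rrun _ _ _ Rk'.
- move=> s g [t g'|g'] Rk'; last by move/Rdone: Rk'.
  have [t' [[es eg] st sim]] := Rrun _ _ _ Rk'; subst t' g'.
  exists t; split=> [||Phi p HPhi] //; first exact: iff_sym.
  by have [h1 h2 h3 h4] := sim _ p HPhi.
Qed.

Lemma wb_closed k1 k2 : weakly_bisimilar k1 k2 -> closed_config k1.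
Proof. by case=> R [Rcl _ _] /Rcl[]. Qed.

Lemma wb_done g k : weakly_bisimilar (Done g) k -> k = Done g.
Proof. by case=> R [_ Rdone _] /Rdone. Qed.

(** Weak bisimilarity satisfies the clauses of a bisimulation itself; only the half starting from
    [s] is kept, the other following by symmetry. *)
Lemma wb_run s g k : weakly_bisimilar (Run s g) k ->
  exists t, [/\ k = Run t g, isSync s -> isSync t
     & forall Phi p l k', environment_move Phi -> trans p (Run s (Phi g)) l k' ->
         exists2 k2, weak p (Run t (Phi g)) l k2 & weakly_bisimilar k' k2].
Proof.
case=> R WR Rk; have [_ _ Rrun] := WR.
have [t [ek st sim]] := Rrun _ _ _ Rk; exists t.
split=> [||Phi p l [s' g'|g'] HPhi h] //.
- exact: (proj1 st).
- have [h1 _ _ _] := sim _ p HPhi; have [t' w Rk'] := h1 _ _ _ h.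
  by exists (Run t' g') => //; exists R.
- have [_ _ h3 _] := sim _ p HPhi; exists (Done g'); first exact: h3.
  exact: wb_refl.
Qed.

Definition bis s t g : Prop := weakly_bisimilar (Run s g) (Run t g).

Lemma bis_sym s t g : bis s t g -> bis t s g.
Proof. exact: wb_sym. Qed.

Lemma bis_closed s t g : bis s t g -> closed s /\ closed t.
Proof. by move=> b; split; [apply: wb_closed b | apply: wb_closed (wb_sym b)]. Qed.

Lemma bis_isSync s t g : bis s t g -> isSync s -> isSync t.
Proof. by move=> /wb_run[t' [[<-] st _]]. Qed.

Lemma bis_isAsync s t g : bis s t g -> isAsync s -> isAsync t.
Proof. by move=> /bis_sym /bis_isSync b /isAsyncP h; apply/isAsyncP => /b. Qed.

(** A move from [g'], preceded by the growth from [g] to [g'], amounts to a move from [g], so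
    whatever is tested at [g'] was already tested at [g]. *)
Lemma bis_heap_le s t g g' : heap_le g g' -> bis s t g -> bis s t g'.
Proof.
move=> gg' b.
exists (fun k1 k2 => (exists g0, k1 = Done g0 /\ k2 = Done g0) \/
  exists s0 t0 g0 g0', [/\ k1 = Run s0 g0', k2 = Run t0 g0', bis s0 t0 g0 &
    heap_le g0 g0']);
  last by right; exists s, t, g, g'.
apply: wb_symmetric_intro.
- move=> k1 k2 [[g0 [-> ->]]|[s0 [t0 [g0 [g0' [-> -> b0 h0]]]]]].
    by left; exists g0.
  by right; exists t0, s0, g0, g0'; split=> //; apply: bis_sym.
- move=> k1 k2 [[g0 [-> _]]|[s0 [t0 [g0 [g0' [-> _ b0 _]]]]]] //=.
  by case: (bis_closed b0).
- by move=> g1 k [[g0 [[->] ->]]|[s0 [t0 [g0 [g0' [//]]]]]].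
- move=> s1 g1 k [[g0 [//]]|[s0 [t0 [g0 [g0' [[-> ->] -> b0 h0]]]]]].
  exists t0; split=> //; first exact: bis_isSync b0.
  move=> Phi p l k' HPhi h.
  (* A single move [Psi] leads from [g0] straight to [Phi g0']. *)
  have [Psi HPsi e] := heap_le_environment_move
    (heap_le_trans h0 (environment_move_le g0' HPhi)).
  rewrite -e in h *; have [t' [[<-] _ sim]] := wb_run b0.
  have [k2 w b'] := sim _ _ _ _ HPsi h; exists k2 => //.
  case: k' b' {h} => [s' g2|g2] b'; last by left; exists g2; rewrite (wb_done b').
  right; have [t'' [ek _ _]] := wb_run b'; subst k2.
  by exists s', t'', g2, g2; split=> //; apply: heap_le_refl.
Qed.

(** The identity is an environment move, so the game covers plain steps without interference. *)
Lemma wb_trans_sim p k1 k2 l k1' : weakly_bisimilar k1 k2 -> trans p k1 l k1' ->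
  exists2 k2', weak p k2 l k2' & weakly_bisimilar k1' k2'.
Proof.
case: k1 => [s g|g] //= b h; have [t [-> _ sim]] := wb_run b.
by apply: (sim id) => //; split=> // *; apply: fsubset_refl.
Qed.

Lemma wb_taus_sim p k1 k2 k1' : weakly_bisimilar k1 k2 -> taus p k1 k1' ->
  exists2 k2', taus p k2 k2' & weakly_bisimilar k1' k2'.
Proof.
move=> b h; elim: h k2 b => {k1 k1'} [k1 k1' h|k1|k1 k k1' _ IH1 _ IH2] k2 b.
- exact: (wb_trans_sim b h).
- by exists k2 => //; apply: rt_refl.
- have [k' h' b'] := IH1 _ b; have [k2' h2 b2] := IH2 _ b'.
  by exists k2' => //; apply: rt_trans h' h2.
Qed.

Lemma wb_weak_sim p k1 k2 l k1' : weakly_bisimilar k1 k2 -> weak p k1 l k1' ->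
  exists2 k2', weak p k2 l k2' & weakly_bisimilar k1' k2'.
Proof.
move=> b /weakP[[-> <-]|[a [c [h1 h2 h3]]]].
  by exists k2 => //; apply: rt_refl.
have [a' w1 ba] := wb_taus_sim b h1; have [c' w2 bc] := wb_trans_sim ba h2.
have [k2' w3 b'] := wb_taus_sim bc h3; exists k2' => //.
apply/weakP; case/weakP: w2 => [[-> e]|[a1 [c1 [v1 v2 v3]]]]; last first.
  by right; exists a1, c1; split=> //;
    [apply: rt_trans w1 v1 | apply: rt_trans v3 w3].
by apply/weakP; rewrite -e in w3; apply: rt_trans w1 w3.
Qed.

(** The environment acts only before a challenge. Moving both bisimilarities to [Phi g] first leaves
    a simulation free of environment moves, so the weak answer of the middle configuration can be
    followed step by step. *)
Lemma wb_trans k1 k2 k3 :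
  weakly_bisimilar k1 k2 -> weakly_bisimilar k2 k3 -> weakly_bisimilar k1 k3.
Proof.
move=> b12 b23.
exists (fun a c => exists2 b, weakly_bisimilar a b & weakly_bisimilar b c);
  last by exists k2.
apply: wb_symmetric_intro.
- by move=> a c [b /wb_sym ? /wb_sym ?]; exists b.
- by move=> a c [b /wb_closed].
- by move=> g c [b /wb_done -> /wb_done].
- move=> s g c [b b1 b2]; have [t [eb st _]] := wb_run b1; subst b.
  have [u [ec tu _]] := wb_run b2; subst c.
  exists u; split=> [||Phi p l k' HPhi h] //; first by move/st.
  have le := environment_move_le g HPhi.
  have [k h' b'] := wb_trans_sim (bis_heap_le le b1) h.
  have [k0 h0 b0] := wb_weak_sim (bis_heap_le le b2) h'.
  by exists k0 => //; exists k.
Qed.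

Lemma bis_trans s t u g : bis s t g -> bis t u g -> bis s u g.
Proof. exact: wb_trans. Qed.

(** * Coinduction up to bisimilarity, and frames *)

(** Successors may leave [R] for bisimilarity, which covers frames that disappear or turn into
    another constructor. *)
Definition up (R : stmt X -> stmt X -> gheap X -> Prop) k1 k2 : Prop :=
  weakly_bisimilar k1 k2 \/
  exists s t g, [/\ k1 = Run s g, k2 = Run t g & R s t g].

Lemma up_run (R : stmt X -> stmt X -> gheap X -> Prop) s t g :
  R s t g -> up R (Run s g) (Run t g).
Proof. by right; exists s, t, g. Qed.

(** Closure of [R] under [heap_le] absorbs the environment, so only steps from the current heap have
    to be answered. *)
Lemma bis_coind (R : stmt X -> stmt X -> gheap X -> Prop) :
  (forall s t g, R s t g -> R t s g) ->
  (forall s t g, R s t g -> closed s) ->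
  (forall s t g, R s t g -> isSync s -> isSync t) ->
  (forall s t g g', heap_le g g' -> R s t g -> R s t g') ->
  (forall s t g p l k, R s t g -> step p s g l k ->
     (place_local g -> place_local (heap_of k)) ->
     exists2 k', weak p (Run t g) l k' & up R k k') ->
  forall s t g, R s t g -> bis s t g.
Proof.
move=> Rsym Rcl Rsync Rheap Rstep s t g Rst; exists (up R); last exact: up_run.
apply: wb_symmetric_intro.
- move=> k1 k2 [/wb_sym|[s1 [t1 [g1 [-> -> R1]]]]]; first by left.
  exact/up_run/Rsym.
- by move=> k1 k2 [/wb_closed //|[s1 [t1 [g1 [-> _ /Rcl]]]]].
- by move=> g1 k [/wb_done //|[s1 [t1 [g2 []]]]].
- move=> s1 g1 k [b|[s2 [t1 [g2 [[-> ->] -> R1]]]]].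
    have [t1 [-> st sim]] := wb_run b; exists t1; split=> // Phi p l k' HPhi h.
    by have [k2 w b2] := sim _ _ _ _ HPhi h; exists k2 => //; left.
  exists t1; split=> //; first exact: Rsync R1.
  move=> Phi p l k' HPhi [h hl]; apply: Rstep h hl.
  exact: Rheap (environment_move_le _ HPhi) R1.
Qed.

(** [G] surrounds a running argument; [r] tells what is left once the argument terminates: [Some u]
    continues with [u], while [None] terminates the whole statement. *)
Definition frame (G : stmt X -> stmt X) (r : option (stmt X)) k : config X :=
  match k with
  | Run s g => Run (G s) g
  | Done g => if r is Some u then Run u g else Done g
  end.

Lemma heap_of_frame G r k : heap_of (frame G r k) = heap_of k.
Proof. by case: k => //= g; case: r. Qed.

Lemma trans_frame p p' l l' G r G' r' k k' :
  (forall t g k, step p' t g l k -> step p (G t) g l' (frame G' r' k)) ->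
  trans p' k l k' -> trans p (frame G r k) l' (frame G' r' k').
Proof.
move=> lift; case: k => // t g [h pl]; split; first exact: lift.
by rewrite heap_of_frame.
Qed.

Lemma taus_frame p p' G r k k' :
  (forall t g k, step p' t g Eps k -> step p (G t) g Eps (frame G r k)) ->
  taus p' k k' -> taus p (frame G r k) (frame G r k').
Proof.
move=> lift; elim=> {k k'} [k k' h|k|k1 k2 k3 _ h1 _ h2].
- by apply: rt_step; apply: trans_frame h.
- exact: rt_refl.
- exact: rt_trans h1 h2.
Qed.

(** The step labelled [l] may change the frame from [G] to [G'], as when an exception discards or
    replaces it. An empty silent transition changes nothing, hence the condition for [l = Eps]. The
    places [p] and [p'] may differ for the sake of [SAtDyn]. *)
Lemma weak_frame p p' l l' G r G' r' t g k :
  (forall t g k, step p' t g Eps k -> step p (G t) g Eps (frame G r k)) ->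
  (forall t g k, step p' t g Eps k -> step p (G' t) g Eps (frame G' r' k)) ->
  (forall t g k, step p' t g l k -> step p (G t) g l' (frame G' r' k)) ->
  (l = Eps -> l' = Eps /\ G = G') ->
  weak p' (Run t g) l k -> weak p (Run (G t) g) l' (frame G' r' k).
Proof.
move=> lift lift' liftl eql /weakP[[el <-]|[k1 [k2 [h1 h2 h3]]]].
  by have [-> ->] := eql el; apply: rt_refl.
exact: weak_intro (taus_frame lift h1) (trans_frame r liftl h2)
  (taus_frame lift' h3).
Qed.

Lemma weak_same_frame p p' l l' G r t g k :
  (forall t g k, step p' t g Eps k -> step p (G t) g Eps (frame G r k)) ->
  (forall t g k, step p' t g l k -> step p (G t) g l' (frame G r k)) ->
  (l = Eps -> l' = Eps) ->
  weak p' (Run t g) l k -> weak p (Run (G t) g) l' (frame G r k).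
Proof. by move=> lift liftl el; apply: (@weak_frame _ _ _ _ G r G r) => // /el. Qed.

Lemma up_frame (R : stmt X -> stmt X -> gheap X -> Prop) G1 r1 G2 r2 k1 k2 :
  weakly_bisimilar k1 k2 ->
  (forall s t g, g = heap_of k1 -> bis s t g ->
    up R (Run (G1 s) g) (Run (G2 t) g)) ->
  match r1, r2 with
  | Some u1, Some u2 => bis u1 u2 (heap_of k1)
  | None, None => True
  | _, _ => False
  end ->
  up R (frame G1 r1 k1) (frame G2 r2 k2).
Proof.
case: k1 => [s g|g] b HR Hr.
  by have [t [e _ _]] := wb_run b; subst k2; apply: HR.
rewrite (wb_done b); left; case: r1 r2 Hr => [u1|] [u2|] //= _.
exact: wb_refl.
Qed.

(** * Inversion and lifting of steps *)

Lemma estep_val p v h l ek : ~ estep p (EVal v) h l ek.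
Proof.
move Ee: (EVal v) => e st; case: st Ee => //; by case.
Qed.

Lemma step_seq_inv p s u g l k : step p (SSeq s u) g l k ->
  [\/ ~~ is_sync_label l /\
      (exists2 k0, step p s g l k0 & k = frame ((@SSeq X)^~ u) (Some u) k0),
      exists2 v : exn, l = Sync v & step p s g l k
    | isAsync s /\
      (exists2 k0, step p u g l k0 & k = frame (SSeq s) (Some s) k0)].
Proof.
move Ea: (SSeq s u) => a st; case: st Ea => //; try by move=> [].
- by move=> {}s t {}g {}l s' g' nl h [-> ->]; apply: Or31; split=> //;
    exists (Run s' g').
- by move=> {}s t {}g {}l g' nl h [-> ->]; apply: Or31; split=> //; exists (Done g').
- by move=> {}s t {}g v {}k h [-> _]; apply: Or32; exists v.
- by move=> t {}s {}g {}l s' g' nl h [-> ->]; apply: Or33; split=> //;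
    exists (Run s' g').
- by move=> t {}s {}g {}l g' nl h [-> ->]; apply: Or33; split=> //; exists (Done g').
Qed.

Lemma step_seql p s u g l k : ~~ is_sync_label l -> step p s g l k ->
  step p (SSeq s u) g l (frame ((@SSeq X)^~ u) (Some u) k).
Proof. by case: k => *; [apply: s_seq | apply: s_seq_done]. Qed.

Lemma step_seqr p s u g l k : isAsync s -> step p u g l k ->
  step p (SSeq s u) g l (frame (SSeq s) (Some s) k).
Proof. by case: k => *; [apply: s_par | apply: s_par_done]. Qed.

Lemma frame_id k : frame id None k = k.
Proof. by case: k. Qed.

Lemma step_try_inv p s u g l k : step p (STry s u) g l k ->
  (~~ is_sync_label l /\
     exists2 k0, step p s g l k0 & k = frame ((@STry X)^~ u) None k0) \/
  (l = Eps /\ exists v : exn, exists2 k0,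
     step p s g (Sync v) k0 & k = frame ((@SSeq X)^~ u) (Some u) k0).
Proof.
move Ea: (STry s u) => a st; case: st Ea => //; try by move=> [].
- by move=> {}s t {}g {}l s' g' nl h [-> ->]; left; split=> //; exists (Run s' g').
- by move=> {}s t {}g {}l g' nl h [-> ->]; left; split=> //; exists (Done g').
- by move=> {}s t {}g v s' g' h [-> ->]; right; split=> //; exists v, (Run s' g').
- by move=> {}s t {}g v g' h [-> ->]; right; split=> //; exists v, (Done g').
Qed.

Lemma step_try p s u g l k : ~~ is_sync_label l -> step p s g l k ->
  step p (STry s u) g l (frame ((@STry X)^~ u) None k).
Proof. by case: k => *; [apply: s_try | apply: s_try_done]. Qed.

Lemma step_catch p s u g (v : exn) k : step p s g (Sync v) k ->
  step p (STry s u) g Eps (frame ((@SSeq X)^~ u) (Some u) k).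
Proof. by case: k => *; [apply: s_try_exn | apply: s_try_exn_done]; eassumption. Qed.

Lemma step_atdyn_inv p q s g l k : step p (SAtDyn q s) g l k ->
  exists2 k0, step q s g l k0 & k = frame (SAtDyn q) None k0.
Proof.
move Ea: (SAtDyn q s) => a st; case: st Ea => //; try by move=> [].
- by move=> q' {}s {}g {}l s' g' h [-> ->]; exists (Run s' g').
- by move=> q' {}s {}g {}l g' h [-> ->]; exists (Done g').
Qed.

Lemma step_atdyn p q s g l k : step q s g l k ->
  step p (SAtDyn q s) g l (frame (SAtDyn q) None k).
Proof. by case: k => *; [apply: s_at | apply: s_at_done]. Qed.

Lemma step_asyncdyn_inv p s g l k : step p (SAsyncDyn s) g l k ->
  exists l0, exists2 k0, step p s g l0 k0 &
    l = label_async l0 /\ k = frame (@SAsyncDyn X) None k0.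
Proof.
move Ea: (SAsyncDyn s) => a st; case: st Ea => //; try by move=> [].
- by move=> {}s {}g {}l s' g' h [->]; exists l, (Run s' g').
- by move=> {}s {}g {}l g' h [->]; exists l, (Done g').
Qed.

Lemma step_asyncdyn p s g l k : step p s g l k ->
  step p (SAsyncDyn s) g (label_async l) (frame (@SAsyncDyn X) None k).
Proof. by case: k => *; [apply: s_async | apply: s_async_done]. Qed.

Lemma step_async_inv p s g l k : step p (SAsync s) g l k ->
  l = Eps /\ k = Run (SAsyncDyn s) g.
Proof.
move Ea: (SAsync s) => a st; case: st Ea => //; try by move=> [].
by move=> {}s {}g [->].
Qed.

(** A [finish] emits a label only at termination, hence the dependence on the target [k] besides the
    collected exceptions. *)
Definition finish_label (mu : {set exn}) k : label :=
  if k is Done _ then if mu == set0 then Eps else Sync exnE else Eps.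

Lemma step_finish_inv p mu s g l k : step p (SFinish mu s) g l k ->
  exists l0, exists2 k0, step p s g l0 k0 &
    l = finish_label (add_label mu l0) k0 /\
    k = frame (SFinish (add_label mu l0)) None k0.
Proof.
move Ea: (SFinish mu s) => a st; case: st Ea => //; try by move=> [].
- by move=> mu' {}s {}g {}l s' g' h [-> ->]; exists l, (Run s' g').
- by move=> mu' {}s {}g {}l g' h [-> ->]; exists l, (Done g').
Qed.

Lemma trans_finish p mu k l k' : trans p k l k' ->
  trans p (frame (SFinish mu) None k) (finish_label (add_label mu l) k')
    (frame (SFinish (add_label mu l)) None k').
Proof.
case: k => // s g [h pl]; split; last by rewrite heap_of_frame.
by case: k' h {pl} => *; [apply: s_finish | apply: s_finish_end].
Qed.

Lemma taus_done p g k : taus p (Done g) k -> k = Done g.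
Proof. by move/(clos_rt_rt1n _ _ _ _) => h; inversion h. Qed.

Lemma taus_weak p k1 k2 l k3 : taus p k1 k2 -> weak p k2 l k3 -> weak p k1 l k3.
Proof.
move=> h /weakP[[-> <-] //|[a [b [h1 h2 h3]]]].
exact: weak_intro (rt_trans _ _ _ _ _ h h1) h2 h3.
Qed.

(** Even a silent run yields [Sync exnE] if it terminates with [mu] nonempty; [weak_frame], whose
    outer label is fixed in advance, does not cover this. *)
Lemma taus_finish p mu s g k : taus p (Run s g) k ->
  weak p (Run (SFinish mu s) g) (finish_label mu k) (frame (SFinish mu) None k).
Proof.
move Ek: (Run s g) => k0 /(clos_rt_rt1n _ _ _ _) h.
elim: h s g Ek => {k0 k} [k|k1 k2 k3 h12 h23 IH] s g Ek; subst; first exact: rt_refl.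
have h := trans_finish mu h12; case: k2 h12 h23 IH h => [s2 g2|g2] h12 h23 IH h.
  by apply: taus_weak (IH _ _ erefl); apply: rt_step.
(* [Done] takes no steps, so the run ends here and this step carries the label of [finish]. *)
rewrite (taus_done (clos_rt1n_rt _ _ _ _ h23)); exact: weak_of_trans h.
Qed.

Lemma weak_finish p mu s g l k : weak p (Run s g) l k ->
  weak p (Run (SFinish mu s) g) (finish_label (add_label mu l) k)
    (frame (SFinish (add_label mu l)) None k).
Proof.
case/weakP=> [[-> <-]|[k1 [k2 [h1 h2 h3]]]]; first exact: rt_refl.
case: k1 h1 h2 => [s1 g1|g1] h1 h2; last by case: h2.
(* Before the step labelled [l] the argument is still running, so [finish] has emitted nothing; from
   then on the collected set includes the exception of [l]. *)
apply: (@taus_weak p _ (frame (SFinish mu) None (Run s1 g1))).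
  exact: (taus_finish mu h1).
have h := trans_finish mu h2; case: k2 h2 h3 h => [s2 g2|g2] h2 h3 h.
  by apply: taus_weak (taus_finish _ h3); apply: rt_step.
rewrite (taus_done h3); exact: weak_of_trans h.
Qed.

(** * Congruence for sequencing, try, placed, async and finish statements *)

(** Both components vary, since the parallel rule runs the second one while the first is still
    present. *)
Lemma bis_seq s t u (w : stmt X) g : bis s t g -> bis u w g ->
  bis (SSeq s u) (SSeq t w) g.
Proof.
move=> bst buw.
pose R a b g := exists s t u (w : stmt X),
  [/\ a = SSeq s u, b = SSeq t w, bis s t g & bis u w g].
apply: (@bis_coind R); last by exists s, t, u, w.
- by move=> a b g0 [s0 [t0 [u0 [w0 [-> -> /bis_sym b1 /bis_sym b2]]]]];
    exists t0, s0, w0, u0.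
- move=> a b g0 [s0 [t0 [u0 [w0 [-> _ /bis_closed[c1 _] /bis_closed[c2 _]]]]]].
  exact/closed_seq.
- move=> a b g0 [s0 [t0 [u0 [w0 [-> -> /bis_isSync b1 /bis_isSync b2]]]]] h.
  by inversion h; [apply/isSync_seql/b1 | apply/isSync_seqr/b2].
- move=> a b g0 g1 le [s0 [t0 [u0 [w0 [-> -> b1 b2]]]]]; exists s0, t0, u0, w0.
  by split=> //; apply: bis_heap_le le _.
move=> a b g0 p l k [s0 [t0 [u0 [w0 [-> -> b1 b2]]]]] /step_seq_inv.
case=> [[nl [k0 h ->]]|[v -> h]|[as0 [k0 h ->]]]; rewrite ?heap_of_frame => pl;
  have le := trans_heap_le (conj h pl).
- have [k1 w1 b'] := wb_trans_sim b1 (conj h pl : trans p (Run _ _) _ _).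
  exists (frame ((@SSeq X)^~ w0) (Some w0) k1).
    by apply: (@weak_same_frame _ _ _ _ ((@SSeq X)^~ w0) (Some w0)) w1 => // *;
      apply: step_seql.
  apply: up_frame => //; last exact: bis_heap_le b2.
  move=> s1 t1 g1 -> b3; apply: up_run; exists s1, t1, u0, w0.
  split=> //; exact: bis_heap_le b2.
- have [k1 w1 b'] := wb_trans_sim b1 (conj h pl : trans p (Run _ _) _ _).
  exists k1; last by left.
  (* The exception discards the continuation, so the frame after it is the identity. *)
  rewrite -[k1]frame_id.
  apply: (@weak_frame p p (Sync v) (Sync v) ((@SSeq X)^~ w0) (Some w0) id) w1 => //.
  + by move=> *; apply: step_seql.
  + by move=> *; rewrite frame_id.
  + by move=> *; rewrite frame_id; apply: s_seq_exn.
- have [k1 w1 b'] := wb_trans_sim b2 (conj h pl : trans p (Run _ _) _ _).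
  (* The idle left component must be asynchronous on the answering side too, which bisimilarity
     guarantees. *)
  exists (frame (SSeq t0) (Some t0) k1).
    apply: (@weak_same_frame _ _ _ _ (SSeq t0) (Some t0)) w1 => // *;
      by apply: step_seqr => //; apply: bis_isAsync b1 as0.
  apply: up_frame => //; last exact: bis_heap_le b1.
  move=> s1 t1 g1 -> b3; apply: up_run; exists s0, t0, s1, t1.
  split=> //; exact: bis_heap_le b1.
Qed.

Lemma bis_try s t u (w : stmt X) g : bis s t g -> bis u w g ->
  bis (STry s u) (STry t w) g.
Proof.
move=> bst buw.
pose R a b g := exists s t u (w : stmt X),
  [/\ a = STry s u, b = STry t w, bis s t g & bis u w g].
apply: (@bis_coind R); last by exists s, t, u, w.
- by move=> a b g0 [s0 [t0 [u0 [w0 [-> -> /bis_sym b1 /bis_sym b2]]]]];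
    exists t0, s0, w0, u0.
- move=> a b g0 [s0 [t0 [u0 [w0 [-> _ /bis_closed[c1 _] /bis_closed[c2 _]]]]]].
  exact/closed_try.
- move=> a b g0 [s0 [t0 [u0 [w0 [-> -> /bis_isSync b1 /bis_isSync b2]]]]] h.
  by inversion h; apply/isSync_try/b1.
- move=> a b g0 g1 le [s0 [t0 [u0 [w0 [-> -> b1 b2]]]]]; exists s0, t0, u0, w0.
  by split=> //; apply: bis_heap_le le _.
move=> a b g0 p l k [s0 [t0 [u0 [w0 [-> -> b1 b2]]]]] /step_try_inv.
case=> [[nl [k0 h ->]]|[-> [v [k0 h ->]]]]; rewrite heap_of_frame => pl;
  have le := trans_heap_le (conj h pl);
  have [k1 w1 b'] := wb_trans_sim b1 (conj h pl : trans p (Run _ _) _ _).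
- exists (frame ((@STry X)^~ w0) None k1).
    by apply: (@weak_same_frame _ _ _ _ ((@STry X)^~ w0) None) w1 => // *;
      apply: step_try.
  apply: up_frame => // s1 t1 g1 -> b3; apply: up_run; exists s1, t1, u0, w0.
  by split=> //; apply: bis_heap_le b2.
(* A caught exception is silent from outside and turns [try] into a sequence with the handler, so
   running successors are related by [bis_seq] rather than by [R]. *)
- exists (frame ((@SSeq X)^~ w0) (Some w0) k1).
    apply: (@weak_frame p p (Sync v) Eps ((@STry X)^~ w0) None) w1 => //.
    + by move=> *; apply: step_try.
    + by move=> *; apply: step_seql.
    + by move=> *; apply: step_catch; eassumption.
  have b2' := bis_heap_le le b2; apply: up_frame => // s1 t1 g1 -> b3.
  by left; apply: bis_seq.
Qed.

Lemma bis_atdyn q s t g : bis s t g -> bis (SAtDyn q s) (SAtDyn q t) g.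
Proof.
move=> bst.
pose R a b g := exists s t, [/\ a = SAtDyn q s, b = SAtDyn q t & bis s t g].
apply: (@bis_coind R); last by exists s, t.
- by move=> a b g0 [s0 [t0 [-> -> /bis_sym b0]]]; exists t0, s0.
- by move=> a b g0 [s0 [t0 [-> _ /bis_closed[]]]].
- move=> a b g0 [s0 [t0 [-> -> /bis_isSync b0]]] h.
  by inversion h; apply/isSync_at/b0.
- move=> a b g0 g1 le [s0 [t0 [-> -> b0]]]; exists s0, t0.
  by split=> //; apply: bis_heap_le b0.
move=> a b g0 p l k [s0 [t0 [-> -> b0]]] /step_atdyn_inv[k0 h ->].
rewrite heap_of_frame => pl.
have [k1 w1 b'] := wb_trans_sim b0 (conj h pl : trans q (Run _ _) _ _).
exists (frame (SAtDyn q) None k1).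
  by apply: (@weak_same_frame _ _ _ _ (SAtDyn q) None) w1 => // *; apply: step_atdyn.
by apply: up_frame => // s1 t1 g1 _ b1; apply: up_run; exists s1, t1.
Qed.

Lemma bis_asyncdyn s t g : bis s t g -> bis (SAsyncDyn s) (SAsyncDyn t) g.
Proof.
move=> bst.
pose R a b g := exists s t, [/\ a = SAsyncDyn s, b = SAsyncDyn t & bis s t g].
apply: (@bis_coind R); last by exists s, t.
- by move=> a b g0 [s0 [t0 [-> -> /bis_sym b0]]]; exists t0, s0.
- by move=> a b g0 [s0 [t0 [-> _ /bis_closed[]]]].
- by move=> a b g0 [s0 [t0 [-> -> _]]] h; inversion h.
- move=> a b g0 g1 le [s0 [t0 [-> -> b0]]]; exists s0, t0.
  by split=> //; apply: bis_heap_le b0.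
move=> a b g0 p l k [s0 [t0 [-> -> b0]]] /step_asyncdyn_inv[l0 [k0 h [-> ->]]].
rewrite heap_of_frame => pl.
have [k1 w1 b'] := wb_trans_sim b0 (conj h pl : trans p (Run _ _) _ _).
exists (frame (@SAsyncDyn X) None k1).
  apply: (@weak_same_frame _ _ _ _ (@SAsyncDyn X) None) w1 => //.
  + by move=> t1 g1 k2; apply: (@step_asyncdyn p t1 g1 Eps).
  + by move=> *; apply: step_asyncdyn.
  + by move->.
by apply: up_frame => // s1 t1 g1 _ b1; apply: up_run; exists s1, t1.
Qed.

Lemma bis_async s t g : bis s t g -> bis (SAsync s) (SAsync t) g.
Proof.
move=> bst.
pose R a b g := exists s t, [/\ a = SAsync s, b = SAsync t & bis s t g].
apply: (@bis_coind R); last by exists s, t.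
- by move=> a b g0 [s0 [t0 [-> -> /bis_sym b0]]]; exists t0, s0.
- by move=> a b g0 [s0 [t0 [-> _ /bis_closed[]]]].
- by move=> a b g0 [s0 [t0 [-> -> _]]] _; constructor.
- move=> a b g0 g1 le [s0 [t0 [-> -> b0]]]; exists s0, t0.
  by split=> //; apply: bis_heap_le b0.
move=> a b g0 p l k [s0 [t0 [-> -> b0]]] /step_async_inv[-> ->] pl.
exists (Run (SAsyncDyn t0) g0); last by left; apply: bis_asyncdyn.
by apply: weak_of_trans; split=> //; apply: s_spawn.
Qed.

Lemma bis_finish mu s t g : bis s t g -> bis (SFinish mu s) (SFinish mu t) g.
Proof.
move=> bst.
(* The set [mu] is not fixed in [R], as it may grow with each exception collected. *)
pose R a b g := exists mu s t, [/\ a = SFinish mu s, b = SFinish mu t & bis s t g].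
apply: (@bis_coind R); last by exists mu, s, t.
- by move=> a b g0 [mu0 [s0 [t0 [-> -> /bis_sym b0]]]]; exists mu0, t0, s0.
- by move=> a b g0 [mu0 [s0 [t0 [-> _ /bis_closed[]]]]].
- by move=> a b g0 [mu0 [s0 [t0 [-> -> _]]]] _; constructor.
- move=> a b g0 g1 le [mu0 [s0 [t0 [-> -> b0]]]]; exists mu0, s0, t0.
  by split=> //; apply: bis_heap_le b0.
move=> a b g0 p l k [mu0 [s0 [t0 [-> -> b0]]]] /step_finish_inv[l0 [k0 h [-> ->]]].
rewrite heap_of_frame => pl.
have [k1 w1 b'] := wb_trans_sim b0 (conj h pl : trans p (Run _ _) _ _).
exists (frame (SFinish (add_label mu0 l0)) None k1); last first.
  apply: up_frame => // s1 t1 g1 _ b1; apply: up_run.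
  by exists (add_label mu0 l0), s1, t1.
(* The label depends only on the collected set and on termination, and bisimilar configurations are
   both running or both terminated. *)
suff -> : finish_label (add_label mu0 l0) k0 = finish_label (add_label mu0 l0) k1.
  exact: weak_finish.
case: k0 {h pl} b' => [s1 g1 /wb_run[t1 [-> _ _]] //|g1 /wb_done -> //].
Qed.

(** * Congruence for the binders val and at *)

Lemma step_val_inv p x e s g l k : step p (SVal x e s) g l k ->
  [\/ exists2 v, e = EVal v & step p (subst x v s) g l k,
      exists e' h', estep p e (g p) l (ERun e' h') /\
        k = Run (SVal x e' s) (gset g p h')
    | exists2 h', estep p e (g p) l (EDone h') & k = Done (gset g p h')].
Proof.
move Ea: (SVal x e s) => a st; case: st Ea => //.
- by move=> y v {}s {}g {}l {}k h [-> -> ->]; apply: Or31; exists v.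
- by case=> // y s0 e0 {}g {}l e' h' h [-> -> ->]; apply: Or32; exists e', h'.
- by case=> // y s0 e0 {}g {}l h' h [-> -> ->]; apply: Or33; exists h'.
Qed.

Lemma step_atval_inv p q x e s g l k : step p (SAt q x e s) g l k ->
  [\/ exists v v' g', [/\ e = EVal v, copy v q g v' g', l = Eps &
        k = Run (SAtDyn q (SSeq (subst x v' s) (SSkip X))) g'],
      exists e' h', estep p e (g p) l (ERun e' h') /\
        k = Run (SAt q x e' s) (gset g p h')
    | exists2 h', estep p e (g p) l (EDone h') & k = Done (gset g p h')].
Proof.
move Ea: (SAt q x e s) => a st; case: st Ea => //.
- by case=> // q0 y s0 e0 {}g {}l e' h' h [-> -> -> ->]; apply: Or32; exists e', h'.
- by case=> // q0 y s0 e0 {}g {}l h' h [-> -> -> ->]; apply: Or33; exists h'.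
- by move=> q0 y v {}s {}g v' g' c [-> -> -> ->]; apply: Or31; exists v, v', g'.
Qed.

(* [val x = v s] is synchronous and takes the steps of [s[v/x]]; the two are
   bisimilar because a source statement is always synchronous as well.  This
   lets [val x = v s] stay put when [s[v/x]] answers a move by staying put. *)
Lemma bis_val_subst x v s g :
  closed (SVal x (EVal v) s) -> bis (SVal x (EVal v) s) (subst x v s) g.
Proof.
move=> cs.
pose R a b (_ : gheap X) := exists x v s, closed (SVal x (EVal v) s) /\
  (a = SVal x (EVal v) s /\ b = subst x v s \/
   b = SVal x (EVal v) s /\ a = subst x v s).
apply: (@bis_coind R); last by exists x, v, s; split=> //; left.
- move=> a b g0 [x0 [v0 [s0 [c0 ab]]]]; exists x0, v0, s0.
  by split=> //; case: ab => ab; [right | left].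
- move=> a b g0 [x0 [v0 [s0 [c0 [[-> _]|[_ ->]]]]]] //.
  by have [_ _ ws fs _] := (closed_val _ _ _).1 c0; apply: closed_subst.
- move=> a b g0 [x0 [v0 [s0 [c0 [[-> ->]|[-> ->]]]]]] _; last by constructor.
  apply: source_isSync; rewrite source_subst.
  by have [_ _ _ _] := (closed_val _ _ _).1 c0.
- by [].
move=> a b g0 p l k [x0 [v0 [s0 [c0 Rab]]]] h pl; exists k; last first.
  left; apply/wb_refl/(step_closed h); case: Rab => [[-> //]|[_ ->]].
  by have [_ _ ws fs _] := (closed_val _ _ _).1 c0; apply: closed_subst.
apply: weak_of_trans; split=> //.
case: Rab h => [[-> ->]|[-> ->]]; last exact: s_val.
case/step_val_inv=> [[w [->]] //|[e' [h' [/estep_val []]]]|[h' /estep_val []]].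
Qed.

(** Both sides evaluate the same [e], so expression steps match exactly until a value is reached; as
    the value is not known in advance, the bodies are compared under every instance. *)
Lemma bis_val x e s t g :
  closed (SVal x e s) -> closed (SVal x e t) ->
  (forall v, bis (subst x v s) (subst x v t) g) ->
  bis (SVal x e s) (SVal x e t) g.
Proof.
move=> cs ct b.
pose R a b g := exists e s t, [/\ a = SVal x e s, b = SVal x e t,
  closed a, closed b & forall v, bis (subst x v s) (subst x v t) g].
apply: (@bis_coind R); last by exists e, s, t.
- move=> a c g0 [e0 [s0 [t0 [-> -> ca cb b0]]]]; exists e0, t0, s0.
  by split=> // v; apply: bis_sym.
- by move=> a c g0 [e0 [s0 [t0 []]]].
- by move=> a c g0 [e0 [s0 [t0 [_ -> _ _ _]]]] _; constructor.
- move=> a c g0 g1 le [e0 [s0 [t0 [-> -> ca cb b0]]]]; exists e0, s0, t0.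
  by split=> // v; apply: bis_heap_le (b0 v).
move=> a c g0 p l k [e0 [s0 [t0 [-> -> ca cb b0]]]] h pl.
case/step_val_inv: (h) => [[v ev _]|[e' [h' [he ek]]]|[h' he ek]]; subst.
(* The left statement is exchanged for its instance, the instances are bisimilar, and the right
   instance is folded back. *)
- have bv : bis (SVal x (EVal v) s0) (SVal x (EVal v) t0) g0.
    apply: bis_trans (bis_val_subst g0 ca) (bis_trans (b0 v) _).
    exact/bis_sym/bis_val_subst.
  have [k' wk bk] := wb_trans_sim bv (conj h pl : trans p (Run _ _) _ _).
  by exists k' => //; left.
- have ht := s_ctx (YVal x t0) he.
  exists (Run (SVal x e' t0) (gset g0 p h')); first exact: weak_of_trans.
  apply: up_run; exists e', s0, t0; split=> // [||v].
  + exact: step_closed h ca.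
  + exact: step_closed ht cb.
  + exact: bis_heap_le (trans_heap_le (conj h pl)) (b0 v).
- have ht := s_ctx_done (YVal x t0) he.
  by exists (Done (gset g0 p h')); [apply: weak_of_trans | left; apply: wb_refl].
Qed.

(** Unlike entering the body of a [val], the place shift is a silent step of its own. The copy
    depends on value, place and heap but not on the body, so both sides reach instances for the same
    copied value. *)
Lemma bis_at q x e s t g :
  closed (SAt q x e s) -> closed (SAt q x e t) ->
  (forall v, bis (subst x v s) (subst x v t) g) ->
  bis (SAt q x e s) (SAt q x e t) g.
Proof.
move=> cs ct b.
pose R a b g := exists e s t, [/\ a = SAt q x e s, b = SAt q x e t,
  closed a, closed b & forall v, bis (subst x v s) (subst x v t) g].
apply: (@bis_coind R); last by exists e, s, t.
- move=> a c g0 [e0 [s0 [t0 [-> -> ca cb b0]]]]; exists e0, t0, s0.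
  by split=> // v; apply: bis_sym.
- by move=> a c g0 [e0 [s0 [t0 []]]].
- by move=> a c g0 [e0 [s0 [t0 [_ -> _ _ _]]]] _; constructor.
- move=> a c g0 g1 le [e0 [s0 [t0 [-> -> ca cb b0]]]]; exists e0, s0, t0.
  by split=> // v; apply: bis_heap_le (b0 v).
move=> a c g0 p l k [e0 [s0 [t0 [-> -> ca cb b0]]]] h pl.
have le := trans_heap_le (conj h pl).
case/step_atval_inv: (h) =>
  [[v [v' [g' [ev hc el ek]]]]|[e' [h' [he ek]]]|[h' he ek]]; subst.
- exists (Run (SAtDyn q (SSeq (subst x v' t0) (SSkip X))) g').
    by apply: weak_of_trans; split=> //; apply: s_shift.
  left; apply/bis_atdyn/bis_seq; first exact: bis_heap_le le (b0 v').
  by apply: wb_refl.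
- have ht := s_ctx (YAt q x t0) he.
  exists (Run (SAt q x e' t0) (gset g0 p h')); first exact: weak_of_trans.
  apply: up_run; exists e', s0, t0; split=> // [||v].
  + exact: step_closed h ca.
  + exact: step_closed ht cb.
  + exact: bis_heap_le le (b0 v).
- have ht := s_ctx_done (YAt q x t0) he.
  by exists (Done (gset g0 p h')); [apply: weak_of_trans | left; apply: wb_refl].
Qed.

(** * Induction on contexts *)

(** The hole is left untouched because only closed statements are plugged into it. *)
Fixpoint csubst x v C : ctx X :=
  match C with
  | CHole => CHole X
  | CVal y e C => CVal y (esubst x v e) (if y == x then C else csubst x v C)
  | CSeqL C t => CSeqL (csubst x v C) (subst x v t)
  | CSeqR t C => CSeqR (subst x v t) (csubst x v C)
  | CAt q y e C => CAt q y (esubst x v e) (if y == x then C else csubst x v C)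
  | CAsync C => CAsync (csubst x v C)
  | CFinish mu C => CFinish mu (csubst x v C)
  | CTryL C t => CTryL (csubst x v C) (subst x v t)
  | CTryR t C => CTryR (subst x v t) (csubst x v C)
  | CAtDyn q C => CAtDyn q (csubst x v C)
  | CAsyncDyn C => CAsyncDyn (csubst x v C)
  end.

(** Measure for the induction on contexts: [csubst x v C] need not be a subterm of the context
    binding [x], but it is only as deep as [C]. *)
Fixpoint depth C : nat :=
  match C with
  | CHole => 0
  | CVal _ _ C | CSeqL C _ | CSeqR _ C | CAt _ _ _ C | CAsync C | CFinish _ C
  | CTryL C _ | CTryR _ C | CAtDyn _ C | CAsyncDyn C => (depth C).+1
  end.

Lemma depth_csubst x v C : depth (csubst x v C) = depth C.
Proof. by elim: C => //= *; try (case: eqP => _); congr S. Qed.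

Lemma subst_plug x v C s :
  fv s = [::] -> subst x v (plug C s) = plug (csubst x v C) s.
Proof.
move=> fs; elim: C => //= [|y e C ->|C ->|t C ->|q y e C ->|C ->|mu C ->|C ->|t C ->
                          |q C ->|C ->] //.
- by rewrite subst_id // fs.
- by case: eqP.
- by case: eqP.
Qed.

Lemma bis_plug s t g C :
  bis s t g -> closed (plug C s) -> closed (plug C t) ->
  bis (plug C s) (plug C t) g.
Proof.
move=> b; have [[_ fs] [_ ft]] := bis_closed b.
have [n] := ubnP (depth C); elim: n C => // n IH C.
have refl u : closed u -> bis u u g by move=> cu; apply: wb_refl.
case: C => [|x e C|C u|u C|q x e C|C|mu C|C u|u C|q C|C] //=; rewrite ltnS => dC.
- move=> cs ct; apply: bis_val => // v.
  have [_ _ ws xs _] := (closed_val _ _ _).1 cs.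
  have [_ _ wt xt _] := (closed_val _ _ _).1 ct.
  rewrite !subst_plug //.
  (* Closedness of the instances is obtained with the substitution pulled back out of the
     context. *)
  by apply: IH; rewrite ?depth_csubst // -subst_plug //; apply: closed_subst.
- by move=> /closed_seq[cs cu] /closed_seq[ct _]; apply: bis_seq; auto.
- by move=> /closed_seq[cu cs] /closed_seq[_ ct]; apply: bis_seq; auto.
- move=> cs ct; apply: bis_at => // v.
  have [_ _ ws xs] := (closed_at _ _ _ _).1 cs.
  have [_ _ wt xt] := (closed_at _ _ _ _).1 ct.
  rewrite !subst_plug //.
  by apply: IH; rewrite ?depth_csubst // -subst_plug //; apply: closed_subst.
- by move=> cs ct; apply/bis_async/IH.
- by move=> cs ct; apply/bis_finish/IH.
- by move=> /closed_try[cs cu] /closed_try[ct _]; apply: bis_try; auto.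
- by move=> /closed_try[cu cs] /closed_try[_ ct]; apply: bis_try; auto.
- by move=> cs ct; apply/bis_atdyn/IH.
- by move=> cs ct; apply/bis_asyncdyn/IH.
Qed.

End Bisimilarity.

Theorem theorem3p3 (X : signature) :
  (forall k : config X, closed_config k -> weakly_bisimilar k k) /\
  (forall k1 k2 : config X, weakly_bisimilar k1 k2 -> weakly_bisimilar k2 k1) /\
  (forall k1 k2 k3 : config X,
     weakly_bisimilar k1 k2 -> weakly_bisimilar k2 k3 -> weakly_bisimilar k1 k3) /\
  (forall (s t : stmt X) (g : gheap X) (C : ctx X),
     weakly_bisimilar (Run s g) (Run t g) ->
     closed (plug C s) -> closed (plug C t) ->
     weakly_bisimilar (Run (plug C s) g) (Run (plug C t) g)).
Proof.
split; first exact: wb_refl.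
split; first exact: wb_sym.
split; first exact: wb_trans.
by move=> s t g C; apply: bis_plug.
Qed.
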